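(* Let $\mathbb{K}\in\{\mathbb{R},\mathbb{C}\}$, let $(\Omega,\Sigma,\mu)$ be a positive measure space, let $p$ be an even positive integer, and let $V_n=\operatorname{lin}_{\mathbb{K}}\{\varphi_1,\ldots,\varphi_n\}\subseteq L_p(\Omega,\mu;\mathbb{K})$ with $\dim_{\mathbb{K}}V_n=n$. Let $$W_n:=\operatorname{lin}_{\mathbb{K}}\Big\{\varphi_1^{k_1}\cdots\varphi_n^{k_n}: k_1,\ldots,k_n\in\mathbb{N}_0,\ k_1+\cdots+k_n=\tfrac p2\Big\}\subseteq L_2(\Omega,\mu;\mathbb{K}).$$ Then there exist $N=\dim_{\mathbb{K}}\operatorname{lin}_{\mathbb{K}}\{f\,\overline{g}: f,g\in W_n\}$ points $x_1,\ldots,x_N\in\Omega$ and non-negative weights $\mu_1,\ldots,\mu_N$ such that $$\int_\Omega|f(x)|^p\,\mathrm{d}\mu(x)=\sum_{j=1}^N\mu_j|f(x_j)|^p\quad\text{for all } f\in V_n.$$ In case $\mathbb{K}=\mathbb{R}$ we have $N\le\binom{n+p-1}{p}$; if $\mathbb{K}=\mathbb{C}$ we have $N\le\binom{n+\frac p2-1}{\frac p2}^2$.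
   Context: $\operatorname{lin}_{\mathbb{K}}$ denotes the $\mathbb{K}$-linear span and $\mathbb{N}_0=\{0,1,2,\ldots\}$. A positive measure is a classical measure with values in $[0,\infty]$. The space $V_n$ is assumed to consist of proper functions $\Omega\to\mathbb{K}$ with unambiguously defined values at each $x\in\Omega$ (if given as equivalence classes, one fixes representatives $\varphi_1,\ldots,\varphi_n$ of a basis and takes the space of functions that is their $\mathbb{K}$-linear span); spans and dimensions are those of spaces of proper functions. *)

(* Defs.v *)
From HB Require Import structures.
From mathcomp Require Import all_boot all_order all_algebra.
From mathcomp Require Import complex.
From mathcomp Require Import all_classical all_reals all_analysis.

Set Implicit Arguments.
Unset Strict Implicit.
Unset Printing Implicit Defensive.

Import Order.TTheory GRing.Theory Num.Theory.
Import numFieldNormedType.Exports.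

Local Open Scope classical_set_scope.
Local Open Scope ring_scope.

Section FunctionSpaces.
Context {K : fieldType} {T : Type}.

(* The ambient space of all functions [T -> K] is in general infinite
   dimensional, so subspaces are sets of functions and dimensions are
   expressed by the existence of a basis. *)
Definition lin_span (S : set (T -> K)) : set (T -> K) :=
  [set f | exists (m : nat) (c : 'I_m -> K) (g : 'I_m -> T -> K),
     (forall i, S (g i)) /\ f = (fun x => \sum_(i < m) c i * g i x)].

Definition lin_indep (n : nat) (b : 'I_n -> T -> K) : Prop :=
  forall c : 'I_n -> K,
    (forall x, \sum_(i < n) c i * b i x = 0) -> forall i, c i = 0.

Definition has_dim (V : set (T -> K)) (n : nat) : Prop :=
  exists b : 'I_n -> T -> K, lin_indep b /\ V = lin_span (range b).

Definition monomials (n : nat) (phi : 'I_n -> T -> K) (m : nat) :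
    set (T -> K) :=
  [set f | exists k : 'I_n -> nat, (\sum_(i < n) k i)%N = m /\
     f = (fun x => \prod_(i < n) phi i x ^+ k i)].

(* [conj] is [id] for real scalars and complex conjugation for complex ones. *)
Definition conj_products (conj : K -> K) (W : set (T -> K)) : set (T -> K) :=
  [set h | exists f g, [/\ W f, W g & h = (fun x => f x * conj (g x))]].

End FunctionSpaces.

Definition cmod {R : realType} (z : R[i]) : R := ComplexField.Normc.normc z.

(* Complex counterpart of [Lfun]; Borel measurability of a complex function
   is measurability of its real and imaginary parts. *)
Definition LfunC d (T : measurableType d) (R : realType)
    (mu : {measure set T -> \bar R}) (p : \bar R) : set (T -> R[i]) :=
  [set f | [/\ measurable_fun [set: T] (fun x => complex.Re (f x)),
               measurable_fun [set: T] (fun x => complex.Im (f x)) &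
               finite_norm mu p (fun x => cmod (f x))]].

(* Main.v *)
Require Import Defs.
From HB Require Import structures.
From mathcomp Require Import all_boot all_order all_algebra.
From mathcomp Require Import complex.
From mathcomp Require Import all_classical all_reals all_analysis.
From mathcomp Require Import measurable_realfun.
From mathcomp Require Import ring lra.

Set Implicit Arguments.
Unset Strict Implicit.
Unset Printing Implicit Defensive.

Import Order.TTheory GRing.Theory Num.Theory.
Import numFieldNormedType.Exports.

Local Open Scope classical_set_scope.
Local Open Scope ring_scope.

(** The identity is an exact quadrature formula for a finite-dimensional space
of integrable functions, namely the span [U] of the products [f * conj g] with
[f], [g] in [W]: raising [f] in [V] to the power [p/2] gives an element of [W],
so [|f|^p = f^(p/2) * conj (f^(p/2))] belongs to [U]. Everything else is
Tchakaloff's theorem for [U], whose number of nodes is [dim U].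

Tchakaloff's theorem is used in the generality of an arbitrary measure space,
without topology or compactness. Put the basis functions of [U] into one map
[u : T -> R^N]. The vector of their integrals must be shown to be a nonnegative
combination of values of [u], that is, to lie in the convex cone generated by
the image of [u]. This cone need not be closed, and the integral of a function
with values in a convex cone nevertheless lies in the cone
([convex_cone_integral]): otherwise a nonzero linear form [l] is nonnegative on
the cone and nonpositive at the integral, so [l (u x)] vanishes almost
everywhere, and one concludes by induction on the dimension inside the
hyperplane [ker l]. Carathéodory's argument then reduces the number of nodes
to [N].

The separation of a point from a convex cone that is not closed
([cone_separation]) comes from a maximal cone avoiding the point, given by
Zorn's lemma. Such a cone is the nonnegative part of a total preorder on [R^N], for which
signed coordinate vectors sum to an order unit [e]; the form [l] sends [x] to
the supremum of the [t] with [t e <= x].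

Integrability is controlled by a single dominating function. With
[s = sum_i |phi_i|], an element of the span of the monomials of degree [m] is
bounded by a multiple of [s^m], so elements of [W] have squares, and elements of
[U] have values, dominated by multiples of [s^p], which is integrable because [s] belongs
to [L_p].

Over the complex numbers [U] is stable under conjugation, hence spanned by its
real-valued members; a basis chosen among them ([basis_within]) reduces the
complex case to the real Tchakaloff theorem with the same [N]. The two bounds
on [N] count generators of [U]: monomials of degree [p] in the real case, and
products of a monomial of degree [p/2] with a conjugate one in the complex
case. *)

(** * Separation of a point from a convex cone *)

Definition convex_cone (R : numDomainType) (V : lmodType R) (K : set V) :=
  [/\ K 0, forall x y, K x -> K y -> K (x + y) &
      forall a x, 0 <= a -> K x -> K (a *: x)].

(** A maximal cone avoiding [v] is total: if neither [x] nor [- x] belongs to it,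
    then adjoining either of them captures [v], and eliminating [x] between
    [v = m + t x] and [v = m' - t' x] puts [v] in the cone. *)
Lemma maximal_cone_avoiding (R : realFieldType) (V : lmodType R) (K : set V)
    (v : V) : convex_cone K -> ~ K v ->
  exists M, [/\ convex_cone M, K `<=` M, ~ M v & forall x, M x \/ M (- x)].
Proof.
move=> coneK Kv.
(* The union with [K] makes the empty chain admissible in Zorn's lemma. *)
pose P := [set A : set V | convex_cone (A `|` K) /\ ~ (A `|` K) v].
have [F FP totF|A [[coneA Av] maxA]] := @Zorn_bigcup _ P.
  have joint x y : ((\bigcup_(X in F) X) `|` K) x ->
      ((\bigcup_(X in F) X) `|` K) y ->
      exists C, [/\ convex_cone C, C x, C y &
        C `<=` (\bigcup_(X in F) X) `|` K].
    have sub A : F A -> A `|` K `<=` (\bigcup_(X in F) X) `|` K.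
      by move=> FA; apply: setSU => z Az; exists A.
    have take A : F A -> (A `|` K) x -> (A `|` K) y -> exists C,
        [/\ convex_cone C, C x, C y & C `<=` (\bigcup_(X in F) X) `|` K].
      by move=> FA Ax Ay; exists (A `|` K); split; [by case: (FP _ FA)|by []|by []|exact: sub].
    case=> [[A FA Ax]|Kx] [[B FB By]|Ky].
    - have [AB|BA] := totF _ _ FA FB.
        by apply: (take B) => //; left => //; exact: AB.
      by apply: (take A) => //; left => //; exact: BA.
    - by apply: (take A) => //; [left|right].
    - by apply: (take B) => //; [right|left].
    - by exists K; split => // z; right.
  split; last first.
    by case=> [[A FA Av]|//]; case: (FP _ FA) => _; apply; left.
  split; first by right; case: coneK.
    move=> x y Fx Fy; have [C [[_ CD _] Cx Cy CF]] := joint _ _ Fx Fy.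
    exact/CF/CD.
  move=> a x a0 Fx; have [C [[_ _ CZ] Cx _ CF]] := joint _ _ Fx Fx.
  exact/CF/CZ.
exists (A `|` K); split => //.
move=> x; have [M0 MD MZ] := coneA.
(* By maximality, the cone generated together with [y] contains [v]. *)
have adjoin y : ~ (A `|` K) y ->
    exists m t, [/\ (A `|` K) m, 0 < t & v = m + t *: y].
  move=> My; pose B := [set z | exists m t, [/\ (A `|` K) m, 0 <= t & z = m + t *: y]].
  have MB : A `|` K `<=` B.
    by move=> z Mz; exists z, 0; split => //; rewrite scale0r addr0.
  have BK : B `|` K = B.
    by apply/seteqP; split => z; [case=> // Kz; apply: MB; right|left].
  have coneB : convex_cone B.
    split; first exact: MB.
      move=> _ _ [m [t [Mm t0 ->]]] [m' [t' [Mm' t0' ->]]].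
      exists (m + m'), (t + t'); split; [exact: MD|exact: addr_ge0|].
      by rewrite scalerDl addrACA.
    move=> a _ a0 [m [t [Mm t0 ->]]]; exists (a *: m), (a * t).
    by split; [exact: MZ|exact: mulr_ge0|rewrite scalerDr scalerA].
  have Bv : B v.
    apply: contrapT => Bv; apply: (maxA B); last by split; rewrite BK.
    split=> [z Az|BA]; first by apply: MB; left.
    apply: My; left; apply: BA; exists 0, 1.
    by split => //; rewrite add0r scale1r.
  have [m [t [Mm]]] := Bv.
  rewrite le_eqVlt => /predU1P[<-|t0 vE]; last by exists m, t.
  by rewrite scale0r addr0 => vm; case: Av; rewrite vm.
apply: contrapT => /not_orP[/adjoin[m [t [Mm t0 vE]]] /adjoin[m' [t' [Mm' t0' vE']]]].
apply: Av.
have -> : v = (t + t')^-1 *: (t' *: m + t *: m').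
  have tt : t + t' != 0 by rewrite gt_eqF ?addr_gt0.
  apply: (scalerI tt); rewrite scalerA divff// scale1r addrC scalerDl.
  by rewrite {1}vE {1}vE' !scalerDr !scalerA scalerN mulrC addrACA subrr addr0.
apply: (MZ); first by rewrite invr_ge0 addr_ge0 ?ltW.
by apply: MD; apply: MZ => //; exact: ltW.
Qed.

(** Only weak separation holds, since [K] need not be closed; what matters for
    the descent on dimension is that [l] is nonzero. Writing [x <= y] when
    [y - x] belongs to the total cone [M], the form [l] is the order-theoretic
    coordinate along an order unit. *)
Lemma cone_separation (R : realType) (N : nat) (K : set 'rV[R]_N) (v : 'rV_N) :
  convex_cone K -> ~ K v ->
  exists l : 'cV[R]_N,
    [/\ l != 0, forall x, K x -> 0 <= (x *m l) 0 0 & (v *m l) 0 0 <= 0].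
Proof.
move=> coneK /(maximal_cone_avoiding coneK)[M [[M0 MD MZ] KM Mv totM]].
pose b (i : 'I_N) : 'rV[R]_N :=
  if pselect (M (delta_mx 0 i)) then delta_mx 0 i else - delta_mx 0 i.
have Mb i : M (b i).
  rewrite /b; case: pselect => // nM; by case: (totM (delta_mx 0 i)).
have Msum (I : Type) (r : seq I) (P : pred I) (F : I -> 'rV[R]_N) :
    (forall i, P i -> M (F i)) -> M (\sum_(i <- r | P i) F i).
  by move=> MF; apply: (big_ind M).
(* [e] dominates every [b i], hence is an order unit. *)
pose e := \sum_i b i.
have eb i : M (e - b i).
  by rewrite /e (bigD1 i)//= addrC addrK; apply: Msum => j _; exact: Mb.
have bound_basis (i : 'I_N) (a : R) : M (`|a| *: e - a *: delta_mx 0 i).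
  have Me : M e by exact: Msum.
  have [ab|ab] : a *: delta_mx 0 i = `|a| *: b i \/
      a *: delta_mx 0 i = - (`|a| *: b i).
  - rewrite /b; case: pselect => /= _; case: (ger0P a) => _.
    + by left.
    + by right; rewrite scaleNr opprK.
    + by right; rewrite scalerN opprK.
    + by left; rewrite scaleNr scalerN opprK.
  - by rewrite ab -scalerBr; apply: MZ.
  - by rewrite ab opprK -scalerDr; apply: MZ => //; exact: MD.
have bound (x : 'rV[R]_N) : M ((\sum_i `|x 0 i|) *: e - x).
  rewrite scaler_suml [X in _ - X]row_sum_delta -sumrB.
  by apply: Msum => i _; exact: bound_basis.
have Me : M e by exact: Msum.
(* If [- e] were nonnegative, every vector would be, including [v]. *)
have Ne c : 0 < c -> ~ M (- (c *: e)).
  move=> c0 MNe; apply: Mv.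
  have := MD _ _ (bound (- v)) (MZ ((\sum_i `|(- v) 0 i|) / c) _ _ MNe).
  rewrite scalerN scalerA divfK ?gt_eqF// opprK addrAC subrr add0r; apply.
  by rewrite divr_ge0 ?sumr_ge0// ltW.
(* [approx x r]: up to infinitesimals, [x] is [r] times [e]. This relation is
   linear in [(x, r)], which makes [l] linear without a study of suprema. *)
pose approx (x : 'rV[R]_N) r := forall d, 0 < d ->
  M (x - (r - d) *: e) /\ M ((r + d) *: e - x).
have approx_ex x : exists r, approx x r.
  pose A := [set t : R | M (x - t *: e)].
  have supA : has_sup A.
    split.
      exists (- \sum_i `|(- x) 0 i|); rewrite /A /= scaleNr opprK addrC.
      by have := bound (- x); rewrite opprK.
    exists (\sum_i `|x 0 i|) => t /= At; rewrite leNgt; apply/negP => lt_t.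
    apply: (Ne (t - \sum_i `|x 0 i|)); first by rewrite subr_gt0.
    have := MD _ _ At (bound x).
    suff -> : x - t *: e + ((\sum_i `|x 0 i|) *: e - x) =
        - ((t - \sum_i `|x 0 i|) *: e) by [].
    by apply/rowP => i; rewrite !mxE; ring.
  exists (sup A) => d d0; split.
    have [t At dt] := sup_adherent d0 supA.
    have -> : x - (sup A - d) *: e = (x - t *: e) + (t - (sup A - d)) *: e.
      by rewrite (scalerBl t) addrA subrK.
    by apply: MD => //; apply: MZ => //; rewrite subr_ge0 ltW.
  case: (totM (x - (sup A + d) *: e)); last by rewrite opprB.
  move=> Ad; have := ub_le_sup supA.2 Ad.
  by rewrite gerDl leNgt d0.
have approxD x y r s : approx x r -> approx y s -> approx (x + y) (r + s).
  move=> xr ys d d0; have d2 : 0 < d / 2 by rewrite divr_gt0.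
  have [x1 x2] := xr _ d2; have [y1 y2] := ys _ d2.
  have rs : r + s - d = (r - d / 2) + (s - d / 2) by lra.
  have rs' : r + s + d = (r + d / 2) + (s + d / 2) by lra.
  split.
    suff -> : x + y - (r + s - d) *: e =
        (x - (r - d / 2) *: e) + (y - (s - d / 2) *: e) by exact: MD.
    by rewrite rs; apply/rowP => i; rewrite !mxE; ring.
  suff -> : (r + s + d) *: e - (x + y) =
      ((r + d / 2) *: e - x) + ((s + d / 2) *: e - y) by exact: MD.
  by rewrite rs'; apply/rowP => i; rewrite !mxE; ring.
have approxZ a x r : approx x r -> approx (a *: x) (a * r).
  move=> xr d d0; have [->|a0] := eqVneq a 0.
    by rewrite !mul0r scale0r subr0 !sub0r add0r scaleNr opprK;
      split; apply: MZ => //; exact: ltW.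
  have [] := xr (d / `|a|); first by rewrite divr_gt0 ?normr_gt0.
  have aV : `|a| != 0 by rewrite normr_eq0.
  move=> /(MZ `|a| _ (normr_ge0 a)) + /(MZ `|a| _ (normr_ge0 a)).
  have -> : `|a| *: (x - (r - d / `|a|) *: e) = `|a| *: x - (`|a| * r - d) *: e.
    by apply/rowP => i; rewrite !mxE; field.
  have -> : `|a| *: ((r + d / `|a|) *: e - x) = (`|a| * r + d) *: e - `|a| *: x.
    by apply/rowP => i; rewrite !mxE; field.
  case: (ger0P a) => _; first by split.
  move=> M1 M2; split.
    suff -> : a *: x - (a * r - d) *: e = (- a * r + d) *: e - (- a *: x) by [].
    by apply/rowP => i; rewrite !mxE; ring.
  suff -> : (a * r + d) *: e - a *: x = - a *: x - (- a * r - d) *: e by [].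
  by apply/rowP => i; rewrite !mxE; ring.
have /choice[l lP] : forall i, exists r, approx (delta_mx 0 i) r.
  by move=> i; exact: approx_ex.
have approx_l x : approx x ((x *m \col_i l i) 0 0).
  rewrite {1}[x]row_sum_delta mxE.
  elim/big_ind2 : _ => [d d0|? ? ? ?|i _]; [|exact: approxD|].
    by rewrite sub0r add0r scaleNr opprK subr0 add0r; split; apply: MZ => //; exact: ltW.
  by rewrite mxE; apply: approxZ.
exists (\col_i l i); split.
- apply/eqP => l0; have /(_ 2^-1)[] := approx_l e; first by rewrite invr_gt0.
  move=> _; rewrite l0 mulmx0 mxE add0r => Mh; apply: (Ne 2^-1); first by rewrite invr_gt0.
  suff -> : - (2^-1 *: e) = 2^-1 *: e - e by [].
  by apply/rowP => i; rewrite !mxE; field.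
- move=> x /KM Mx; rewrite leNgt; apply/negP; set r := (X in X < 0) => r0.
  have [_] := approx_l x (- r / 2) ltac:(lra).
  rewrite -/r => /MD/(_ Mx); rewrite subrK.
  have -> : r + - r / 2 = - (- r / 2) by field.
  by rewrite scaleNr => /Ne; apply; lra.
- rewrite leNgt; apply/negP; set r := (X in 0 < X) => r0.
  have MNv : M (- v) by case: (totM v).
  have [+ _] := approx_l v (r / 2) ltac:(lra).
  rewrite -/r => /MD/(_ MNv).
  have -> : v - (r - r / 2) *: e - v = - ((r / 2) *: e).
    by apply/rowP => i; rewrite !mxE; field.
  by move=> /Ne; apply; lra.
Qed.

(** * Integrals of functions with values in a convex cone *)

Section integral_in_cone.
Context (R : realType) (d : measure_display) (T : measurableType d).
Variable mu : {measure set T -> \bar R}.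

Definition vintegrable (N : nat) (u : T -> 'rV[R]_N) :=
  forall i, mu.-integrable setT (EFin \o (fun x => u x 0 i)).

Definition vintegral (N : nat) (u : T -> 'rV[R]_N) : 'rV[R]_N :=
  \row_i (\int[mu]_x u x 0 i).

Lemma vintegral_mulmx (N k : nat) (u : T -> 'rV[R]_N) (A : 'M[R]_(N, k)) :
  vintegrable u -> vintegrable (fun x => u x *m A) /\
  vintegral (fun x => u x *m A) = vintegral u *m A.
Proof.
move=> iu.
have step (r : seq 'I_N) j :
    integrable mu setT (EFin \o (fun x => \sum_(i <- r) u x 0 i * A i j)) /\
    \int[mu]_x (\sum_(i <- r) u x 0 i * A i j) =
      \sum_(i <- r) (\int[mu]_x u x 0 i) * A i j.
  elim: r => [|a r [ir Ir]].
    split.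
      under [X in integrable _ _ X]eq_fun do rewrite /= big_nil.
      exact: integrable0.
    rewrite big_nil; under eq_Rintegral do rewrite big_nil.
    by rewrite /Rintegral integral0.
  have ia : mu.-integrable setT (EFin \o (fun x => u x 0 a * A a j)).
    by have := integrableZr measurableT (A a j) (iu a).
  split.
    have := integrableD measurableT ia ir.
    by apply: eq_integrable => // x _; rewrite /= big_cons EFinD.
  rewrite big_cons -Ir -RintegralZr// -RintegralD//.
  by apply: eq_Rintegral => x _; rewrite big_cons.
split=> [j|].
  have [+ _] := step (index_enum 'I_N) j.
  by apply: eq_integrable => // x _; rewrite /= mxE.
apply/rowP => j; rewrite !mxE.
under eq_bigr do rewrite mxE.
have [_ <-] := step (index_enum _) j.
by apply: eq_Rintegral => x _; rewrite mxE.
Qed.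

Lemma Rintegral_ae_ge0_le0_eq0 (f : T -> R) :
  mu.-integrable setT (EFin \o f) -> {ae mu, forall x, 0 <= f x} ->
  \int[mu]_x f x <= 0 -> {ae mu, forall x, f x = 0} /\ \int[mu]_x f x = 0.
Proof.
move=> intf f0 If.
have mf := measurable_int mu intf.
have abs_f : (\int[mu]_x `|(EFin \o f) x| = \int[mu]_x (EFin \o f) x)%E.
  apply: ae_eq_integral => //; first exact/(measurable_int mu)/integrable_abse.
  by apply: filterS f0 => x fx _ /=; rewrite ger0_norm.
have abs0 : (\int[mu]_x `|(EFin \o f) x| = 0)%E.
  apply/eqP; rewrite eq_le integral_ge0 ?andbT; last by move=> *; exact: abse_ge0.
  rewrite abs_f -(fineK (integrable_fin_num measurableT intf)) lee_fin.
  exact: If.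
split; last by rewrite /Rintegral -abs_f abs0.
move/(ae_eq_integral_abs mu measurableT mf) : abs0.
by apply: filterS => x /(_ I) [].
Qed.

(** Convexity alone suffices: where a closed cone would allow weak limits, an
    integral escaping [K] is separated from it by some [l]; then [l (u x)] is
    nonnegative with nonpositive integral, so [u] lives almost everywhere in
    the hyperplane [ker l], and the dimension drops. *)
Lemma convex_cone_integral (N : nat) (K : set 'rV[R]_N) (u : T -> 'rV[R]_N) :
  convex_cone K -> vintegrable u -> {ae mu, forall x, K (u x)} ->
  K (vintegral u).
Proof.
elim/ltn_ind: N K u => N IH K u coneK iu Ku.
apply: contrapT => nKI; have [l [l0 lK lI]] := cone_separation coneK nKI.
have [iul Iul] := vintegral_mulmx l iu.
have [lu0 lI0] : {ae mu, forall x, (u x *m l) 0 0 = 0} /\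
    \int[mu]_x (u x *m l) 0 0 = 0.
  apply: Rintegral_ae_ge0_le0_eq0; first exact: iul.
    by apply: filterS Ku => x /lK.
  by rewrite -Iul mxE in lI.
(* The rows of [B] form a basis of [ker l]; [y *m pinvmx B] are the coordinates
   of [y] in it. *)
set B := row_base (kermx l).
have ltN : (\rank (kermx l) < N)%N.
  have rl : (0 < \rank l)%N by rewrite lt0n mxrank_eq0.
  by rewrite mxrank_ker ltn_subrL rl (leq_trans rl) ?rank_leq_row.
have subB (y : 'rV_N) : (y *m l) 0 0 = 0 -> (y <= B)%MS.
  by move=> yl; rewrite eq_row_base; apply/sub_kermxP/rowP => i; rewrite ord1 yl mxE.
have [iuB IuB] := vintegral_mulmx (pinvmx B) iu.
have K'I : K (vintegral u *m pinvmx B *m B).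
  rewrite -IuB; apply: (IH _ ltN [set y | K (y *m B)]) => //.
    have [K0 KD KZ] := coneK; split; first by rewrite /= mul0mx.
      by move=> x y; rewrite /= mulmxDl; exact: KD.
    by move=> a x; rewrite /= -scalemxAl; exact: KZ.
  apply: filterS2 Ku lu0 => x Kux lux.
  by rewrite /= (mulmxKpV (subB _ lux)).
have /mulmxKpV IB : (vintegral u <= B)%MS by apply: subB; rewrite -Iul mxE.
by apply: nKI; rewrite -IB.
Qed.

End integral_in_cone.

(** * Quadrature with few nodes *)

(** More than [N] vectors of [R^N] are dependent, and moving the weights along a
    dependency until the first of them vanishes removes a vector. *)
Lemma conic_caratheodory (R : realFieldType) (N m : nat) (s : 'I_m -> 'rV[R]_N)
    (w : 'I_m -> R) : (forall j, 0 <= w j) ->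
  exists m' (e : 'I_m' -> 'I_m) (w' : 'I_m' -> R),
    [/\ (m' <= N)%N, forall j, 0 <= w' j &
        \sum_j w j *: s j = \sum_j w' j *: s (e j)].
Proof.
elim: m s w => [|m IH] s w w0.
  by exists 0%N, id, w; split => //; rewrite !big_ord0.
have [mN|Nm] := leqP m.+1 N; first by exists m.+1, id, w.
have dep : exists c : 'rV[R]_m.+1, c != 0 /\ \sum_j c 0 j *: s j = 0.
  pose S := \matrix_(i < m.+1) s i.
  have : kermx S != 0.
    by rewrite kermx_eq0 /row_free neq_ltn (leq_ltn_trans (rank_leq_col S) Nm).
  move=> /rowV0Pn[c /sub_kermxP cS c0]; exists c; split=> //.
  by rewrite -[RHS]cS mulmx_sum_row; apply: eq_bigr => i _; rewrite rowK.
have [c [c0 cs]] : exists c : 'rV[R]_m.+1,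
    (exists j, 0 < c 0 j) /\ \sum_j c 0 j *: s j = 0.
  have [c [c0 cs]] := dep.
  have [j cj] : exists j, c 0 j != 0.
    apply/existsP; apply: contraNT c0; rewrite negb_exists => /forallP cE.
    by apply/eqP/rowP => j; rewrite mxE; exact/eqP/negbNE.
  have [cj_gt0|] := ltP 0 (c 0 j); first by exists c; split => //; exists j.
  rewrite le_eqVlt (negbTE cj)/= => cj_lt0; exists (- c); split.
    by exists j; rewrite mxE oppr_gt0.
  by under eq_bigr do rewrite mxE scaleNr; rewrite sumrN cs oppr0.
have [j0 cj0] := c0.
have [i0 ci0 min_i0] :=
  arg_minP (P := fun i => 0 < c 0 i) (fun i => w i / c 0 i) cj0.
(* The smallest ratio keeps all weights nonnegative and cancels the one of
   [i0]. *)
pose a := w i0 / c 0 i0; pose w' j := w j - a * c 0 j.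
have w'0 j : 0 <= w' j.
  rewrite subr_ge0; have [cj|cj] := ltP 0 (c 0 j).
    by rewrite -ler_pdivlMr//; exact: min_i0.
  by rewrite (le_trans _ (w0 j))// mulr_ge0_le0// divr_ge0// ltW.
have w'i0 : w' i0 = 0 by rewrite /w' /a divfK ?subrr// gt_eqF.
have [m' [e [w'' [m'N w''0 w''E]]]] :=
  IH (fun j => s (lift i0 j)) (fun j => w' (lift i0 j)) (fun j => w'0 _).
exists m', (fun j => lift i0 (e j)), w''; split => //.
rewrite -w''E; transitivity (\sum_j w' j *: s j).
  under [RHS]eq_bigr do rewrite scalerBl -scalerA.
  by rewrite sumrB -scaler_sumr cs scaler0 subr0.
by rewrite (bigD1_ord i0)//= w'i0 scale0r add0r.
Qed.

(** Nodes missing from the reduced combination are padded with weight zero,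
    which requires a point of [T]. *)
Lemma tchakaloff (R : realType) (d : measure_display) (T : measurableType d)
    (mu : {measure set T -> \bar R}) (N : nat) (u : 'I_N -> T -> R) :
  (forall i, mu.-integrable setT (EFin \o u i)) ->
  ((0 < N)%N -> inhabited T) ->
  exists (x : 'I_N -> T) (w : 'I_N -> R), (forall j, 0 <= w j) /\
    forall i, \int[mu]_t u i t = \sum_(j < N) w j * u i (x j).
Proof.
move=> iu inhT; pose U t := \row_i u i t.
have UE t i : U t 0 i = u i t by rewrite mxE.
pose K := [set v : 'rV[R]_N | exists (m : nat) (x : 'I_m -> T) (w : 'I_m -> R),
  (forall j, 0 <= w j) /\ v = \sum_j w j *: U (x j)].
have coneK : convex_cone K.
  split.
  - have none : 'I_0 -> T by case.
    exists 0%N, none, (fun=> 0).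
    by split=> //; rewrite big_ord0.
  - move=> _ _ [m [x [w [w0 ->]]]] [m' [x' [w' [w0' ->]]]].
    pose glue A (f : 'I_m -> A) (g : 'I_m' -> A) j :=
      match fintype.split j with inl i => f i | inr i => g i end.
    exists (m + m')%N, (glue _ x x'), (glue _ w w'); split.
      by move=> j; rewrite /glue; case: fintype.split.
    rewrite big_split_ord/=; congr (_ + _); apply: eq_bigr => i _.
      by rewrite /glue (unsplitK (inl i)).
    by rewrite /glue (unsplitK (inr i)).
  - move=> a _ a0 [m [x [w [w0 ->]]]]; exists m, x, (fun j => a * w j).
    split; first by move=> j; exact: mulr_ge0.
    by rewrite scaler_sumr; apply: eq_bigr => j _; rewrite scalerA.
have KU t : K (U t).
  by exists 1%N, (fun=> t), (fun=> 1); split => //; rewrite big_ord1 scale1r.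
have [] := @convex_cone_integral _ _ _ mu N K U coneK.
- by move=> i; apply: eq_integrable (iu i) => // t _; rewrite /= UE.
- exact: nearW.
move=> m [x [w [w0 IE]]].
have [m' [e [w' [m'N w'0 w'E]]]] := conic_caratheodory (fun j => U (x j)) w0.
have IuE i : \int[mu]_t u i t = \sum_j w' j * u i (x (e j)).
  have /rowP/(_ i) := IE; rewrite w'E summxE mxE.
  under eq_Rintegral do rewrite UE.
  by move=> ->; apply: eq_bigr => j _; rewrite mxE UE.
pose lookup A (a : A) (f : 'I_m' -> A) (j : 'I_N) :=
  if insub (val j) is Some i then f i else a.
have [N0|/inhT[t0]] := posnP N.
  have none : 'I_N -> T by rewrite N0; case.
  by exists none, (fun=> 0); split=> // i; move: (ltn_ord i); rewrite [X in (_ < X)%N]N0.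
exists (lookup T t0 (fun j => x (e j))), (lookup R 0 w').
split; first by move=> j; rewrite /lookup; case: insubP.
move=> i; rewrite IuE.
pose G k := oapp (fun j : 'I_m' => w' j * u i (x (e j))) 0 (insub k).
transitivity (\sum_(j < m') G j).
  by apply: eq_bigr => j _; rewrite /G valK.
rewrite (big_ord_widen N G m'N) big_mkcond; apply: eq_bigr => j _.
by rewrite /G /lookup; case: insubP => [k -> _|/negbTE ->] //=; rewrite mul0r.
Qed.

(** * Spans of functions and their bases *)

Section spans.
Context {K : fieldType} {T : Type}.
Implicit Types (S : set (T -> K)) (f g : T -> K).

Lemma lin_span0 S : lin_span S (fun=> 0).
Proof.
have none : 'I_0 -> T -> K by case.
exists 0%N, (fun=> 0), none; split; first by case.
by apply/funext => x; rewrite big_ord0.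
Qed.

Lemma lin_spanD S f g :
  lin_span S f -> lin_span S g -> lin_span S (fun x => f x + g x).
Proof.
move=> [m [c [h [Sh ->]]]] [m' [c' [h' [Sh' ->]]]].
pose glue A (a : 'I_m -> A) (b : 'I_m' -> A) j :=
  match fintype.split j with inl i => a i | inr i => b i end.
exists (m + m')%N, (glue _ c c'), (glue _ h h'); split.
  by move=> j; rewrite /glue; case: fintype.split.
apply/funext => x; rewrite big_split_ord; congr (_ + _); apply: eq_bigr => i _.
  by rewrite /glue (unsplitK (inl i)).
by rewrite /glue (unsplitK (inr i)).
Qed.

Lemma lin_spanZ S a f : lin_span S f -> lin_span S (fun x => a * f x).
Proof.
move=> [m [c [h [Sh ->]]]]; exists m, (fun i => a * c i), h; split => //.
by apply/funext => x; rewrite mulr_sumr; apply: eq_bigr => i _; rewrite mulrA.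
Qed.

Lemma sub_lin_span S : S `<=` lin_span S.
Proof.
move=> f Sf; exists 1%N, (fun=> 1), (fun=> f); split => //.
by apply/funext => x; rewrite big_ord1 mul1r.
Qed.

Lemma lin_span_ind S (P : set (T -> K)) :
  P (fun=> 0) ->
  (forall a g f, S g -> P f -> P (fun x => a * g x + f x)) ->
  lin_span S `<=` P.
Proof.
move=> P0 PD f [m [c [g [Sg ->]]]]; elim: m c g Sg => [|m IH] c g Sg.
  by rewrite (_ : (fun _ => _) = fun=> 0)//; apply/funext => x; rewrite big_ord0.
rewrite (_ : (fun _ => _) = fun x => c ord0 * g ord0 x +
  \sum_(i < m) c (lift ord0 i) * g (lift ord0 i) x).
  by apply: PD => //; exact: (IH (fun i => c (lift ord0 i)) (fun i => g (lift ord0 i))).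
by apply/funext => x; rewrite big_ord_recl.
Qed.

Lemma lin_span_min S S' : S `<=` lin_span S' -> lin_span S `<=` lin_span S'.
Proof.
move=> SS'; apply: lin_span_ind; first exact: lin_span0.
by move=> a g f /SS' Sg Sf; apply: lin_spanD => //; exact: lin_spanZ.
Qed.

Lemma lin_span_rangeP (I : finType) (g : I -> T -> K) f :
  lin_span (range g) f -> exists c : I -> K, f = (fun x => \sum_i c i * g i x).
Proof.
move: f; apply: lin_span_ind.
  by exists (fun=> 0); apply/funext => x; rewrite big1// => i _; rewrite mul0r.
move=> a _ _ [j _ <-] [c ->]; exists (fun i => a *+ (i == j) + c i).
apply/funext => x; rewrite (bigD1 j)//= [in RHS](bigD1 j)//= eqxx mulr1n.
rewrite mulrDl -addrA; congr (_ + (_ + _)).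
by apply: eq_bigr => i /negbTE ->; rewrite mulr0n add0r.
Qed.

Lemma lin_span_family (I : finType) (g : I -> T -> K) (c : I -> K) :
  lin_span (range g) (fun x => \sum_i c i * g i x).
Proof.
have step (r : seq I) : lin_span (range g) (fun x => \sum_(i <- r) c i * g i x).
  elim: r => [|i r IH]; first by under [X in lin_span _ X]eq_fun do rewrite big_nil; exact: lin_span0.
  under [X in lin_span _ X]eq_fun do rewrite big_cons.
  apply: lin_spanD => //; apply: lin_spanZ.
  by apply: sub_lin_span; exists i.
exact: step.
Qed.

Lemma lin_span_mul S S' S'' :
  (forall f g, S f -> S' g -> lin_span S'' (fun x => f x * g x)) ->
  forall f g, lin_span S f -> lin_span S' g -> lin_span S'' (fun x => f x * g x).
Proof.
move=> SS' f g Sf S'g.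
have left_mul h : S h -> lin_span S'' (fun x => h x * g x).
  move=> Sh; move: g S'g; apply: lin_span_ind.
    by under eq_fun do rewrite mulr0; exact: lin_span0.
  move=> a k f' S'k IH.
  under eq_fun do rewrite mulrDr mulrCA.
  by apply: lin_spanD => //; apply: lin_spanZ; exact: SS'.
move: f Sf; apply: lin_span_ind.
  by under eq_fun do rewrite mul0r; exact: lin_span0.
move=> a k f' Sk IH; under eq_fun do rewrite mulrDl -mulrA.
by apply: lin_spanD => //; apply: lin_spanZ; exact: left_mul.
Qed.

Lemma lin_indep_leq (N : nat) (I : finType) (b : 'I_N -> T -> K)
    (g : I -> T -> K) :
  lin_indep b -> (forall i, lin_span (range g) (b i)) -> (N <= #|I|)%N.
Proof.
move=> bfree bg; rewrite leqNgt; apply/negP => ltN.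
have /choice[C CE] i := lin_span_rangeP (bg i).
pose A := \matrix_(i < N, j < #|I|) C i (enum_val j).
have : kermx A != 0.
  by rewrite kermx_eq0 /row_free neq_ltn (leq_ltn_trans (rank_leq_col A) ltN).
move=> /rowV0Pn[c /sub_kermxP cA /negP]; apply.
apply/eqP/rowP => i; rewrite mxE; move: i; apply: bfree => x.
under eq_bigr do rewrite CE mulr_sumr.
rewrite exchange_big big1//= => j _.
have /rowP/(_ (enum_rank j)) := cA; rewrite !mxE => cAj.
apply: etrans (_ : (\sum_i c 0 i * A i (enum_rank j)) * g j x = 0); last first.
  by rewrite cAj mul0r.
rewrite mulr_suml; apply: eq_bigr => i _.
by rewrite mxE enum_rankK mulrA.
Qed.

(** A largest independent family of members of [S] is a basis of the span.
    Taking the basis inside [S] is what provides real-valued bases of spaces of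
    complex functions. *)
Lemma basis_within (I : finType) (g : I -> T -> K) S :
  S `<=` lin_span (range g) ->
  exists N (b : 'I_N -> T -> K),
    [/\ (N <= #|I|)%N, forall i, S (b i), lin_indep b &
        lin_span S = lin_span (range b)].
Proof.
move=> Sg.
pose P N := `[< exists b : 'I_N -> T -> K, (forall i, S (b i)) /\ lin_indep b >].
have PN N : P N -> (N <= #|I|)%N.
  move=> /asboolP[b [Sb bfree]]; apply: (lin_indep_leq (g := g) bfree) => i.
  exact: Sg.
have exP : exists N, P N.
  have none : 'I_0 -> T -> K by case.
  by exists 0%N; apply/asboolP; exists none; split; [case|move=> c _ []].
case: (ex_maxnP exP PN) => N /[dup] /PN leN /asboolP[b [Sb bfree]] maxN.
exists N, b; split => //; apply/seteqP; split; last first.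
  by apply: lin_span_min => _ [i _ <-]; exact: sub_lin_span.
apply: lin_span_min => f Sf.
pose b' (i : 'I_N.+1) : T -> K := if unlift ord0 i is Some j then b j else f.
have : ~ lin_indep b'.
  move=> b'free; have : P N.+1.
    apply/asboolP; exists b'; split=> // i; rewrite /b'.
    by case: unlift.
  by move=> /maxN; rewrite ltnn.
move=> /existsNP[c /not_implyP[c0 /existsNP[i0 ci0]]].
have cE x : c ord0 * f x + \sum_(i < N) c (lift ord0 i) * b i x = 0.
  rewrite -[RHS](c0 x) big_ord_recl /b' unlift_none; congr (_ + _).
  by apply: eq_bigr => i _; rewrite liftK.
have c00 : c ord0 != 0.
  apply/eqP => c00; apply: ci0.
  have [j ->|->//] := unliftP ord0 i0.
  apply: (bfree (fun j => c (lift ord0 j))) => x.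
  by have := cE x; rewrite c00 mul0r add0r.
exists N, (fun i => - (c ord0)^-1 * c (lift ord0 i)), b; split.
  by move=> i; exists i.
apply/funext => x; under eq_bigr do rewrite -mulrA.
rewrite -mulr_sumr; apply: (mulfI c00); rewrite mulrA mulrN divff// mulN1r.
by apply/eqP; rewrite -addr_eq0 cE.
Qed.

(** * Spans of monomials *)

Section monomials.
Context {n : nat}.
Variable phi : 'I_n -> T -> K.

Lemma monomialsM k l f g : monomials phi k f -> monomials phi l g ->
  monomials phi (k + l) (fun x => f x * g x).
Proof.
move=> [a [<- ->]] [b [<- ->]]; exists (fun i => a i + b i)%N.
rewrite big_split; split => //; apply/funext => x.
by rewrite -big_split; apply: eq_bigr => i _; rewrite exprD.
Qed.

Lemma lin_span_monomialsM k l f g :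
  lin_span (monomials phi k) f -> lin_span (monomials phi l) g ->
  lin_span (monomials phi (k + l)) (fun x => f x * g x).
Proof.
apply: lin_span_mul => f' g' f'k g'l.
by apply: sub_lin_span; exact: monomialsM.
Qed.

Lemma lin_span_expr m f :
  lin_span (range phi) f -> lin_span (monomials phi m) (fun x => f x ^+ m).
Proof.
have deg1 : range phi `<=` monomials phi 1.
  move=> _ [i _ <-]; exists (fun j => nat_of_bool (j == i)); split.
    by rewrite (bigD1 i)//= eqxx big1// => j /negbTE ->.
  apply/funext => x; rewrite (bigD1 i)//= eqxx expr1 big1 ?mulr1//.
  by move=> j /negbTE ->.
move=> Vf; elim: m => [|m IH].
  apply: sub_lin_span; exists (fun=> 0%N); split; first by rewrite big1.
  by apply/funext => x; rewrite big1// => i _; rewrite expr0.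
under eq_fun do rewrite exprS.
apply: (lin_span_monomialsM (k := 1)) => //.
by apply: lin_span_min Vf => h /deg1; exact: sub_lin_span.
Qed.

(** Exponent vectors of total degree [m] are the weak compositions of [m] into
    [n] parts, so stars and bars gives their number. *)
Lemma monomials_finite m : (0 < m)%N ->
  exists (I : finType) (g : I -> T -> K),
    #|I| = 'C(n + m - 1, m) /\ monomials phi m `<=` range g.
Proof.
move=> m0; have [n0|n0] := posnP n.
  have none : 'I_0 -> T -> K by case.
  exists 'I_0, none; split; first by rewrite card_ord n0 add0n bin_small// subn1 prednK.
  move=> f [k [km _]]; exfalso; move: m0; rewrite -km big1// => i _.
  by move: (ltn_ord i); rewrite [X in (_ < X)%N]n0.
pose D := [set t : n.-1.+1.-tuple 'I_m.+1 | \sum_(i <- t) i == m]%N%SET.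
pose idx (i : 'I_n) : 'I_n.-1.+1 := cast_ord (esym (prednK n0)) i.
exists {t | t \in D}, 
  (fun t x => \prod_i phi i x ^+ (tnth (sval t) (idx i) : 'I_m.+1)); split.
  rewrite card_sig (eq_card (B := D)) // card_ord_partitions -bin_sub ?leq_addr//.
  by rewrite addKn -[in RHS](prednK n0) addSn subn1.
move=> _ [k [km ->]].
have ltk i : (k i < m.+1)%N by rewrite ltnS -km (bigD1 i)//= leq_addr.
pose back (i : 'I_n.-1.+1) : 'I_n := cast_ord (prednK n0) i.
pose t := [tuple Ordinal (ltk (back i)) | i < n.-1.+1].
have backK i : back (idx i) = i by exact: val_inj.
have tD : t \in D.
  rewrite inE big_tuple -[X in _ == X]km; apply/eqP.
  rewrite (reindex idx); last by exists back => i _; exact: val_inj.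
  by apply: eq_bigr => i _; rewrite tnth_mktuple /= backK.
exists (exist _ t tD) => //; apply/funext => x; apply: eq_bigr => i _.
by rewrite tnth_mktuple /= backK.
Qed.

End monomials.
End spans.

(** * Domination and integrability *)

Section domination.
Context (K : fieldType) (R : realDomainType) (nu : K -> R) (T : Type) (n : nat).
Variable phi : 'I_n -> T -> K.
Hypotheses (nu0 : nu 0 = 0) (nu_ge0 : forall a, 0 <= nu a).
Hypotheses (nuM : {morph nu : a b / a * b}) (nu1 : nu 1 = 1).
Hypothesis nuD : forall a b, nu (a + b) <= nu a + nu b.

(** The absolute value is an abstract multiplicative norm [nu], to serve both the
    real and the complex modulus. Bounding by a power of the sum, instead of a
    sum of powers, avoids any convexity inequality. *)
Lemma monomial_span_bound m f : lin_span (monomials phi m) f ->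
  exists2 C, 0 <= C & forall t, nu (f t) <= C * (\sum_i nu (phi i t)) ^+ m.
Proof.
move: f; apply: lin_span_ind.
  by exists 0 => // t; rewrite nu0 mul0r.
move=> a _ f [k [<- ->]] [C C0 fC]; exists (nu a + C); first exact: addr_ge0.
move=> t; rewrite mulrDl; apply: le_trans (nuD _ _) _; apply: lerD => //.
rewrite nuM ler_wpM2l// (big_morph nu nuM nu1) expr_sum.
apply: ler_prod => i _; rewrite nu_ge0/=.
have -> : nu (phi i t ^+ k i) = nu (phi i t) ^+ k i.
  by elim: (k i) => [|l IH]; rewrite ?expr0// !exprS nuM IH.
apply: lerXn2r; rewrite ?nnegrE ?sumr_ge0//.
by rewrite (bigD1 i)//= lerDl sumr_ge0.
Qed.

End domination.

Lemma monomial_span_closed (K : fieldType) (T : Type) (n m : nat)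
    (phi : 'I_n -> T -> K) (P : set (T -> K)) :
  (forall c, P (fun=> c)) ->
  (forall f g, P f -> P g -> P (fun t => f t + g t)) ->
  (forall f g, P f -> P g -> P (fun t => f t * g t)) ->
  (forall i, P (phi i)) -> lin_span (monomials phi m) `<=` P.
Proof.
move=> Pc PD PM Pphi; apply: lin_span_ind; first exact: Pc.
move=> a _ f [k [_ ->]] Pf; apply: (PD) => //; apply: (PM) => //.
have PX i l : P (fun t => phi i t ^+ l).
  elim: l => [|l IH]; first exact: Pc.
  by under eq_fun do rewrite exprS; exact: PM.
have step (r : seq 'I_n) : P (fun t => \prod_(i <- r) phi i t ^+ k i).
  elim: r => [|i r IH]; first by under eq_fun do rewrite big_nil; exact: Pc.
  by under eq_fun do rewrite big_cons; exact: PM.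
exact: step.
Qed.

Section integrability.
Context (R : realType) (d : measure_display) (T : measurableType d).
Variable mu : {measure set T -> \bar R}.

Lemma integrable_exp_sum (p n : nat) (h : 'I_n -> T -> R) : (0 < p)%N ->
  (forall i t, 0 <= h i t) -> (forall i, h i \in Lfun mu p%:R%:E) ->
  mu.-integrable setT (EFin \o (fun t => (\sum_i h i t) ^+ p)).
Proof.
move=> p0 h0 hL.
have p1 : (1 <= p%:R :> R) by rewrite ler1n.
have p1e : (1 <= p%:R%:E :> \bar R)%E by rewrite lee_fin.
have sumL : (fun t => \sum_i h i t) \in Lfun mu p%:R%:E.
  have -> : (fun t => \sum_i h i t) = \sum_i h i.
    by apply/funext => t; rewrite fct_sumE.
  have [L0 LD] := Lfun_addr_closed mu p1e.
  by apply: (big_ind (fun f => f \in Lfun mu p%:R%:E)) => // i _; exact: hL.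
apply: eq_integrable (Lfun_integrable p1 sumL) => // t _ /=.
by rewrite powR_mulrn// ger0_norm// sumr_ge0.
Qed.

Lemma finite_norm_integrable (q : nat) (h : T -> R) : 
  mu.-integrable setT (EFin \o (fun t => `|h t| ^+ q)) ->
  finite_norm mu q%:R%:E h.
Proof.
move=> /integrable_lty => /(_ measurableT) lty.
rewrite /finite_norm unlock poweR_lty//; apply: le_lt_trans lty.
under eq_integral do rewrite /= powR_mulrn//.
by [].
Qed.

Lemma integrable_dominated (f G : T -> R) : measurable_fun setT f ->
  mu.-integrable setT (EFin \o G) -> (forall t, `|f t| <= G t) ->
  mu.-integrable setT (EFin \o f).
Proof.
move=> mf iG fG; apply: le_integrable iG => //; first exact/measurable_EFinP.
by move=> t _ /=; rewrite lee_fin (le_trans (fG t))// ler_norm.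
Qed.

(** The integral is linear, so the formula extends from [u] to its span. *)
Lemma tchakaloff_span (N : nat) (u : 'I_N -> T -> R) :
  (forall i, mu.-integrable setT (EFin \o u i)) ->
  ((0 < N)%N -> inhabited T) ->
  exists (x : 'I_N -> T) (w : 'I_N -> R), (forall j, 0 <= w j) /\
    forall h, lin_span (range u) h ->
      (\int[mu]_t (h t)%:E = (\sum_(j < N) w j * h (x j))%:E)%E.
Proof.
move=> iu inhT; have [x [w [w0 IE]]] := tchakaloff iu inhT.
exists x, w; split => // h /lin_span_rangeP[c ->].
pose U t := \row_i u i t.
have iU : vintegrable mu U.
  by move=> i; apply: eq_integrable (iu i) => // t _; rewrite /= mxE.
have [iUc IUc] := vintegral_mulmx (\col_i c i) iU.
have UcE t : (U t *m \col_i c i) 0 0 = \sum_i c i * u i t.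
  by rewrite mxE; apply: eq_bigr => i _; rewrite !mxE mulrC.
under eq_integral do rewrite -UcE.
rewrite -[LHS]fineK; last exact: integrable_fin_num (iUc 0).
have /rowP/(_ 0) := IUc; rewrite mxE /Rintegral => ->; congr EFin.
rewrite mxE.
under eq_bigr do rewrite !mxE.
under [RHS]eq_bigr do rewrite mulr_sumr.
rewrite exchange_big; apply: eq_bigr => i _.
under eq_Rintegral do rewrite mxE.
by rewrite IE mulr_suml; apply: eq_bigr => j _; rewrite mulrCA mulrC.
Qed.

End integrability.

Lemma lin_indep_inhabited (K : fieldType) (T : Type) (N : nat)
    (b : 'I_N -> T -> K) : lin_indep b -> (0 < N)%N -> inhabited T.
Proof.
move=> bfree N0; apply: contrapT => noT.
have : (1 : K) = 0 by apply: (bfree (fun=> 1) _ (Ordinal N0)) => x; case: noT.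
by move/eqP; rewrite oner_eq0.
Qed.

(** * Real scalars *)

Lemma LfunE (R : realType) (d : measure_display) (T : measurableType d)
    (mu : {measure set T -> \bar R}) (q : \bar R) (f : T -> R) :
  (f \in Lfun mu q) <-> measurable_fun setT f /\ finite_norm mu q f.
Proof.
rewrite inE; split; first by move=> /andP[/[!inE]].
by move=> [mf ff]; apply/andP; rewrite !inE.
Qed.

Section real_scalars.
Context (R : realType) (d : measure_display) (T : measurableType d).
Variables (mu : {measure set T -> \bar R}) (p n : nat).
Hypotheses (p_gt0 : (0 < p)%N) (p_even : ~~ odd p).
Variable phi : 'I_n -> T -> R.
Let V := lin_span (range phi).
Let W := lin_span (monomials phi p./2).
Hypothesis VL : V `<=` [set f | f \in Lfun mu p%:R%:E].

Let halfD : (p./2 + p./2 = p)%N.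
Proof. by rewrite addnn even_halfK. Qed.

Let G t := (\sum_i `|phi i t|) ^+ p.

Let iG : mu.-integrable setT (EFin \o G).
Proof.
apply: integrable_exp_sum => // i.
have : phi i \in Lfun mu p%:R%:E by apply: VL; apply: sub_lin_span; exists i.
move=> /LfunE[mphi nphi]; apply/LfunE; split; first exact: measurableT_comp.
have absE : 'N[mu]_p%:R%:E[EFin \o (Num.norm \o phi i)]%E =
  'N[mu]_p%:R%:E[EFin \o phi i]%E := Lnorm_abse mu (EFin \o phi i) p%:R%:E.
by rewrite /finite_norm [X in (X < _)%E]absE.
Qed.

Let measurable_W f : W f -> measurable_fun setT f.
Proof.
apply: monomial_span_closed => [c|g h|g h|i]; first exact: measurable_cst.
- exact: measurable_funD.
- exact: measurable_funM.
have : phi i \in Lfun mu p%:R%:E by apply: VL; apply: sub_lin_span; exists i.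
by move=> /LfunE[].
Qed.

Let W_bound f : W f ->
  exists2 C, 0 <= C & forall t, `|f t| <= C * (\sum_i `|phi i t|) ^+ p./2.
Proof.
apply: (@monomial_span_bound _ _ Num.norm) => //.
- exact: normr0.
- exact: normrM.
- exact: normr1.
- exact: ler_normD.
Qed.

Let integrable_WW f g : W f -> W g ->
  mu.-integrable setT (EFin \o (fun t => f t * g t)).
Proof.
move=> Wf Wg; have [C C0 fC] := W_bound Wf; have [D D0 gD] := W_bound Wg.
apply: (integrable_dominated (G := fun t => (C * D) * G t)).
- by apply: measurable_funM; exact: measurable_W.
- by have := integrableZl measurableT (C * D) iG; under eq_fun do rewrite -EFinM.
- by move=> t; rewrite normrM /G -halfD exprD mulrACA ler_pM.
Qed.

Lemma real_W_sub_L2 : W `<=` [set f | f \in Lfun mu 2%:R%:E].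
Proof.
move=> f Wf; apply/LfunE; split; first exact: measurable_W.
apply: finite_norm_integrable.
apply: eq_integrable (integrable_WW Wf Wf) => // t _ /=.
by rewrite real_normK ?num_real// expr2.
Qed.

Lemma real_quadrature : exists N : nat,
  [/\ has_dim (lin_span (conj_products id W)) N,
      exists (x : 'I_N -> T) (w : 'I_N -> R),
        (forall j, 0 <= w j) /\
        (forall f, V f ->
           (\int[mu]_t (`|f t| ^+ p)%:E =
            (\sum_(j < N) w j * `|f (x j)| ^+ p)%:E)%E) &
      (N <= 'C(n + p - 1, p))%N].
Proof.
have [I [g [cardI monI]]] := monomials_finite phi p_gt0.
have Sg : conj_products id W `<=` lin_span (range g).
  move=> _ [f [h [Wf Wh ->]]].
  apply: (lin_span_min (S := monomials phi p)).
    by move=> k /monI; exact: sub_lin_span.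
  by rewrite -halfD; exact: lin_span_monomialsM.
have [N [b [leN bS bfree bspan]]] := basis_within Sg.
exists N; split; first by exists b.
- have ib i : mu.-integrable setT (EFin \o b i).
    by have [f [h [Wf Wh ->]]] := bS i; exact: integrable_WW.
  have [x [w [w0 wE]]] := tchakaloff_span ib (lin_indep_inhabited bfree).
  exists x, w; split => // f Vf.
  have : lin_span (range b) (fun t => `|f t| ^+ p).
    rewrite -bspan; apply: sub_lin_span.
    have Wf := lin_span_expr p./2 Vf.
    exists (fun t => f t ^+ p./2), (fun t => f t ^+ p./2); split => //.
    apply/funext => t; rewrite -exprD halfD -normrX ger0_norm//.
    by rewrite exprn_even_ge0.
  by move=> /wE.
- by rewrite -cardI.
Qed.

End real_scalars.

(** * Complex scalars *)

Section complex_scalars.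
Context (R : realType) (d : measure_display) (T : measurableType d).
Variables (mu : {measure set T -> \bar R}) (p n : nat).
Hypotheses (p_gt0 : (0 < p)%N) (p_even : ~~ odd p).
Variable phi : 'I_n -> T -> R[i].
Let V := lin_span (range phi).
Let W := lin_span (monomials phi p./2).
Hypothesis VL : V `<=` LfunC mu p%:R%:E.

Let halfD : (p./2 + p./2 = p)%N.
Proof. by rewrite addnn even_halfK. Qed.

Let ReM (a b : R[i]) :
  complex.Re (a * b) = complex.Re a * complex.Re b - complex.Im a * complex.Im b.
Proof. by case: a b => [? ?] [? ?]. Qed.

Let ImM (a b : R[i]) :
  complex.Im (a * b) = complex.Re a * complex.Im b + complex.Im a * complex.Re b.
Proof. by case: a b => [? ?] [? ?]. Qed.

Let ReD (a b : R[i]) : complex.Re (a + b) = complex.Re a + complex.Re b.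
Proof. by case: a b => [? ?] [? ?]. Qed.

Let ImD (a b : R[i]) : complex.Im (a + b) = complex.Im a + complex.Im b.
Proof. by case: a b => [? ?] [? ?]. Qed.

Let ReJ (a : R[i]) : complex.Re (conjc a) = complex.Re a.
Proof. by case: a. Qed.

Let ImJ (a : R[i]) : complex.Im (conjc a) = - complex.Im a.
Proof. by case: a. Qed.

Let cmodE (z : R[i]) : cmod z = Num.sqrt (complex.Re z ^+ 2 + complex.Im z ^+ 2).
Proof. by case: z. Qed.

Let cmod_ge0 (z : R[i]) : 0 <= cmod z.
Proof. by rewrite cmodE sqrtr_ge0. Qed.

Let sqr_cmod (z : R[i]) : z * conjc z = (cmod z ^+ 2)%:C%C.
Proof.
rewrite cmodE sqr_sqrtr ?addr_ge0 ?sqr_ge0//; case: z => a b /=.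
by congr (_ +i* _)%C; ring.
Qed.

Let Re_le_cmod (z : R[i]) : `|complex.Re z| <= cmod z.
Proof. by rewrite cmodE -sqrtr_sqr ler_wsqrtr// lerDl sqr_ge0. Qed.

Let Im_le_cmod (z : R[i]) : `|complex.Im z| <= cmod z.
Proof. by rewrite cmodE -sqrtr_sqr ler_wsqrtr// lerDr sqr_ge0. Qed.

Let cmodJ (z : R[i]) : cmod (conjc z) = cmod z.
Proof. by rewrite !cmodE ReJ ImJ sqrrN. Qed.

Let cmodM : {morph (@cmod R) : a b / a * b}.
Proof. by move=> a b; exact: ComplexField.Normc.normcM. Qed.

Let cmodX (z : R[i]) k : cmod (z ^+ k) = cmod z ^+ k.
Proof.
elim: k => [|k IH]; last by rewrite !exprS cmodM IH.
by rewrite !expr0; exact: ComplexField.Normc.normc1.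
Qed.

Let cmeasurable (f : T -> R[i]) :=
  measurable_fun setT (fun t => complex.Re (f t)) /\
  measurable_fun setT (fun t => complex.Im (f t)).

Let measurable_cmod f : cmeasurable f -> measurable_fun setT (fun t => cmod (f t)).
Proof.
move=> [mr mi]; under eq_fun do rewrite cmodE.
apply: (measurableT_comp (f := @Num.sqrt R)); last first.
  by apply: measurable_funD; exact: measurable_funX.
by apply: continuous_measurable_fun; exact: sqrt_continuous.
Qed.

Let cmeasurableM f g : cmeasurable f -> cmeasurable g ->
  cmeasurable (fun t => f t * g t).
Proof.
move=> [fr fi] [gr gi]; split.
  under eq_fun do rewrite ReM.
  by apply: measurable_funB; exact: measurable_funM.
under eq_fun do rewrite ImM.
by apply: measurable_funD; exact: measurable_funM.
Qed.

Let cmeasurableJ f : cmeasurable f -> cmeasurable (fun t => conjc (f t)).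
Proof.
move=> [fr fi]; split; first by under eq_fun do rewrite ReJ.
by under eq_fun do rewrite ImJ; exact: measurable_funN.
Qed.

Let G t := (\sum_i cmod (phi i t)) ^+ p.

Let phiL i : LfunC mu p%:R%:E (phi i).
Proof. by apply: VL; apply: sub_lin_span; exists i. Qed.

Let iG : mu.-integrable setT (EFin \o G).
Proof.
apply: integrable_exp_sum => // i; have [mr mi nphi] := phiL i.
by apply/LfunE; split => //; exact: measurable_cmod.
Qed.

Let cmeasurable_W f : W f -> cmeasurable f.
Proof.
apply: (monomial_span_closed (P := cmeasurable)) => [c|g h [gr gi] [hr hi]|g h|i].
- by split; exact: measurable_cst.
- split; first by under eq_fun do rewrite ReD; exact: measurable_funD.
  by under eq_fun do rewrite ImD; exact: measurable_funD.
- exact: cmeasurableM.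
- by have [mr mi _] := phiL i.
Qed.

Let W_bound f : W f ->
  exists2 C, 0 <= C & forall t, cmod (f t) <= C * (\sum_i cmod (phi i t)) ^+ p./2.
Proof.
apply: (@monomial_span_bound _ _ (@cmod R)) => //.
- exact: ComplexField.Normc.normc0.
- exact: ComplexField.Normc.normc1.
- exact: le_normcD.
Qed.

Let WW_bound f g : W f -> W g ->
  exists C, forall t, cmod (f t) * cmod (g t) <= C * G t.
Proof.
move=> Wf Wg; have [C C0 fC] := W_bound Wf; have [D D0 gD] := W_bound Wg.
by exists (C * D) => t; rewrite /G -halfD exprD mulrACA ler_pM.
Qed.

Let dominatedG (h : T -> R) C : measurable_fun setT h ->
  (forall t, `|h t| <= C * G t) -> mu.-integrable setT (EFin \o h).
Proof.
move=> mh hC; apply: (integrable_dominated mh _ hC).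
by have := integrableZl measurableT C iG; under eq_fun do rewrite -EFinM.
Qed.

Lemma complex_W_sub_L2 : W `<=` LfunC mu 2%:R%:E.
Proof.
move=> f Wf; have mf := cmeasurable_W Wf; have [mr mi] := mf; split => //.
have [C fC] := WW_bound Wf Wf.
apply: finite_norm_integrable; apply: (dominatedG (C := C)).
  by apply: measurable_funX; apply: measurableT_comp => //; exact: measurable_cmod.
move=> t; rewrite ger0_norm ?exprn_ge0// ger0_norm// expr2; exact: fC.
Qed.

Let S := conj_products (@conjc R) W.

Let S_J h : S h -> S (fun t => conjc (h t)).
Proof.
move=> [f [g [Wf Wg ->]]]; exists g, f; split => //.
by apply/funext => t; rewrite rmorphM/= conjcK mulrC.
Qed.

(** The induction over the span carries real and imaginary parts together,
    because complex scalars mix them. *)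
Let integrable_span h : lin_span S h ->
  mu.-integrable setT (EFin \o (fun t => complex.Re (h t))) /\
  mu.-integrable setT (EFin \o (fun t => complex.Im (h t))).
Proof.
pose ok h := mu.-integrable setT (EFin \o (fun t => complex.Re (h t))) /\
  mu.-integrable setT (EFin \o (fun t => complex.Im (h t))).
have intZD (a : R) u v : mu.-integrable setT (EFin \o u) ->
    mu.-integrable setT (EFin \o v) ->
    mu.-integrable setT (EFin \o (fun t => a * u t + v t)).
  move=> iu iv; have := integrableD measurableT (integrableZl measurableT a iu) iv.
  by apply: eq_integrable => // t _; rewrite /= EFinD EFinM.
move: h; apply: (lin_span_ind (P := ok)).
  by split; apply: eq_integrable (integrable0 _ _) => // t _ /=.
move=> a _ f [g1 [g2 [Wg1 Wg2 ->]]] [fr fi].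
have [C gC] := WW_bound Wg1 Wg2.
have [gr gi] : cmeasurable (fun t => g1 t * conjc (g2 t)).
  by apply: cmeasurableM; [|apply: cmeasurableJ]; exact: cmeasurable_W.
have ir : mu.-integrable setT (EFin \o (fun t => complex.Re (g1 t * conjc (g2 t)))).
  apply: (dominatedG (C := C)) => // t.
  by rewrite (le_trans (Re_le_cmod _))// cmodM cmodJ.
have ii : mu.-integrable setT (EFin \o (fun t => complex.Im (g1 t * conjc (g2 t)))).
  apply: (dominatedG (C := C)) => // t.
  by rewrite (le_trans (Im_le_cmod _))// cmodM cmodJ.
split.
  apply: eq_integrable (intZD (complex.Re a) _ _ ir (intZD (- complex.Im a) _ _ ii fr)) => // t _.
  by rewrite /= ReD (ReM a) mulNr addrA.
apply: eq_integrable (intZD (complex.Re a) _ _ ii (intZD (complex.Im a) _ _ ir fi)) => // t _.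
by rewrite /= ImD (ImM a) addrA.
Qed.

Let Sreal : set (T -> R[i]) :=
  [set h | lin_span S h /\ forall t, complex.Im (h t) = 0].

(** [Re h] and [Im h] are complex combinations of [h] and [conj h], both of which
    lie in the span when [h] does. *)
Let span_Sreal : lin_span S = lin_span Sreal.
Proof.
apply/seteqP; split; last by apply: lin_span_min => h [].
apply: lin_span_min => h Sh.
have Sh' := sub_lin_span Sh; have ShJ := sub_lin_span (S_J Sh).
have combo (c c' : R[i]) (r : R[i] -> R[i]) :
    (forall z, c * z + c' * conjc z = r z) -> lin_span S (fun t => r (h t)).
  move=> cr; under eq_fun do rewrite -cr.
  by apply: lin_spanD; exact: lin_spanZ.
have Re_h : Sreal (fun t => (complex.Re (h t))%:C%C).
  split => //; apply: (combo (2^-1)%:C%C (2^-1)%:C%C (fun z => (complex.Re z)%:C%C)) => z.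
  apply/eqP; rewrite eq_complex ReD ImD !ReM !ImM ReJ ImJ/=.
  by apply/andP; split; apply/eqP; field.
have Im_h : Sreal (fun t => (complex.Im (h t))%:C%C).
  split => //.
  apply: (combo (0 +i* - 2^-1)%C (0 +i* 2^-1)%C (fun z => (complex.Im z)%:C%C)) => z.
  apply/eqP; rewrite eq_complex ReD ImD !ReM !ImM ReJ ImJ/=.
  by apply/andP; split; apply/eqP; field.
have := lin_spanD (sub_lin_span Re_h) (lin_spanZ 'i%C (sub_lin_span Im_h)).
rewrite [X in lin_span _ X -> _](_ : _ = h)//.
apply/funext => t; apply/eqP; rewrite eq_complex ReD ImD ReM ImM/=.
by apply/andP; split; apply/eqP; ring.
Qed.

Lemma complex_quadrature : exists N : nat,
  [/\ has_dim (lin_span S) N,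
      exists (x : 'I_N -> T) (w : 'I_N -> R),
        (forall j, 0 <= w j) /\
        (forall f, V f ->
           (\int[mu]_t (cmod (f t) ^+ p)%:E =
            (\sum_(j < N) w j * cmod (f (x j)) ^+ p)%:E)%E) &
      (N <= 'C(n + p./2 - 1, p./2) ^ 2)%N].
Proof.
have half_gt0 : (0 < p./2)%N.
  by rewrite lt0n; apply: contraTneq p_gt0 => p0; rewrite -halfD p0.
have [I [g [cardI monI]]] := monomials_finite phi half_gt0.
pose gg (ij : I * I) t := g ij.1 t * conjc (g ij.2 t).
have Sg : S `<=` lin_span (range gg).
  have Wg : W `<=` lin_span (range g).
    by apply: lin_span_min => k /monI; exact: sub_lin_span.
  have WJ f : W f -> lin_span (range (fun i t => conjc (g i t))) (fun t => conjc (f t)).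
    move=> /Wg/lin_span_rangeP[c ->].
    under [X in lin_span _ X]eq_fun do
      [rewrite rmorph_sum; under eq_bigr do rewrite rmorphM].
    exact: lin_span_family.
  move=> _ [f [h [Wf Wh ->]]].
  apply: (lin_span_mul (S := range g) (S' := range (fun i t => conjc (g i t)))).
  - move=> _ _ [i _ <-] [j _ <-]; apply: sub_lin_span; exists (i, j) => //.
  - exact: Wg.
  - exact: WJ.
have Sg' : Sreal `<=` lin_span (range gg).
  by move=> h [Sh _]; exact: lin_span_min Sh.
have [N [b [leN bS bfree bspan]]] := basis_within Sg'.
exists N; split; first by exists b; rewrite span_Sreal.
- pose u i t := complex.Re (b i t).
  have iu i : mu.-integrable setT (EFin \o u i).
    by have [Sb _] := bS i; have [] := integrable_span Sb.
  have [x [w [w0 wE]]] := tchakaloff_span iu (lin_indep_inhabited bfree).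
  exists x, w; split => // f Vf; apply: (wE (fun t => cmod (f t) ^+ p)).
  have : lin_span (range b) (fun t => (cmod (f t) ^+ p)%:C%C).
    rewrite -bspan -span_Sreal; apply: sub_lin_span.
    have Wf := lin_span_expr p./2 Vf.
    exists (fun t => f t ^+ p./2), (fun t => f t ^+ p./2); split => //.
    by apply/funext => t; rewrite sqr_cmod cmodX -exprM muln2 even_halfK.
  move=> /lin_span_rangeP[c cE].
  (* The [b i] being real-valued, real parts of the coefficients suffice. *)
  exists N, (fun i => complex.Re (c i)), u; split; first by move=> i; exists i.
  apply/funext => t; have /(congr1 (@complex.Re R))/= -> := congr1 (@^~ t) cE.
  rewrite (big_morph _ ReD (erefl _)); apply: eq_bigr => i _.
  by rewrite ReM (bS i).2 mulr0 subr0.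
- by move: leN; rewrite card_prod cardI mulnn.
Qed.

End complex_scalars.

(** * The quadrature theorem *)

Theorem theorem5p5 (R : realType) (d : measure_display)
    (T : measurableType d) (mu : {measure set T -> \bar R})
    (p n : nat) (p_gt0 : (0 < p)%N) (p_even : ~~ odd p) :
  (forall phi : 'I_n -> T -> R,
     let V := lin_span (range phi) in
     let W := lin_span (monomials phi p./2) in
     has_dim V n ->
     V `<=` [set f | f \in Lfun mu p%:R%:E] ->
     W `<=` [set f | f \in Lfun mu 2%:R%:E] /\
     exists N : nat,
       [/\ has_dim (lin_span (conj_products id W)) N,
           exists (x : 'I_N -> T) (w : 'I_N -> R),
             (forall j, 0 <= w j) /\
             (forall f, V f ->
                (\int[mu]_t (`|f t| ^+ p)%:E =
                 (\sum_(j < N) w j * `|f (x j)| ^+ p)%:E)%E) &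
           (N <= 'C(n + p - 1, p))%N])
  /\
  (forall phi : 'I_n -> T -> R[i],
     let V := lin_span (range phi) in
     let W := lin_span (monomials phi p./2) in
     has_dim V n ->
     V `<=` LfunC mu p%:R%:E ->
     W `<=` LfunC mu 2%:R%:E /\
     exists N : nat,
       [/\ has_dim (lin_span (conj_products conjc W)) N,
           exists (x : 'I_N -> T) (w : 'I_N -> R),
             (forall j, 0 <= w j) /\
             (forall f, V f ->
                (\int[mu]_t (cmod (f t) ^+ p)%:E =
                 (\sum_(j < N) w j * cmod (f (x j)) ^+ p)%:E)%E) &
           (N <= 'C(n + p./2 - 1, p./2) ^ 2)%N]).
Proof.
split=> phi V W _ VL.
  split; [exact: real_W_sub_L2 VL|exact: real_quadrature VL].
split; [exact: complex_W_sub_L2 VL|exact: complex_quadrature VL].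
Qed.
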